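(* Let $f:\mathbb{R}^n\to\mathbb{R}$ be twice continuously differentiable and let $x^0\in\mathbb{R}^n$ be such that $\mathscr{L}_f(x^0)$ is compact. Let $U_g,U_H,r_d$ be as in the context, and suppose that for some $\nu\in(0,1]$ and $H_f\ge 1$ one has $\|\nabla^2 f(y)-\nabla^2 f(x)\|\le H_f\|y-x\|^\nu$ for all $x,y\in\mathscr{L}_f(x^0;r_d)$. Let $x^*$ be an arbitrary nondegenerate local minimizer of $f$, with $\nabla^2 f(x^* )\succeq\mu I$ for some $\mu>0$. Then there exists $\delta>0$ such that, for the sequence $\{x^k\}_{k\ge0}$ generated by Algorithm 1 (described in the context, run with exponent $\nu$ from $x^0$), if $x^{k_0}\in B_\delta(x^* )$ for some $k_0\ge0$, then $\{x^k\}_{k\ge k_0}\subseteq B_\delta(x^* )$ and $\{x^k\}_{k\ge k_0}$ converges to $x^*$ superlinearly in the sense that $$\|x^{k+1}-x^*\|\le \mathcal{O}\Big(\|x^k-x^*\|^{\frac{1+2\nu}{1+\nu}}\Big),\qquad k\ge k_0,$$ i.e. there is a constant $C$ independent of $k$ with $\|x^{k+1}-x^*\|\le C\|x^k-x^*\|^{(1+2\nu)/(1+\nu)}$ for all $k\ge k_0$ (if the algorithm terminates, the assertions concern the iterates that are generated).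
   Context: Notation. $\|\cdot\|$ is the Euclidean norm of vectors and the spectral norm of matrices; $B_\delta(x^* )$ is the Euclidean ball of radius $\delta$ centered at $x^*$; $\mathrm{sgn}(z)=1$ if $z\ge 0$ and $-1$ if $z<0$. $\mathscr{L}_f(u)=\{x: f(x)\le f(u)\}$ and, for $r\ge 0$, $\mathscr{L}_f(u;r)=\{x:\|x-x'\|\le r \text{ for some } x'\in\mathscr{L}_f(u)\}$. Since $\mathscr{L}_f(x^0)$ is compact, fix $U_g>0$, $U_H>0$ with $\|\nabla f(x)\|\le U_g$, $\|\nabla^2 f(x)\|\le U_H$ for all $x\in\mathscr{L}_f(x^0)$, and set $r_d=\max\{1.1,1.1U_g,U_H\}$. Residuals and local estimators: $\mathcal{R}_0(y,x)=|f(y)-f(x)-\nabla f(x)^T(y-x)-\frac12(y-x)^T\nabla^2 f(x)(y-x)|$, $\mathcal{R}_1(y,x)=\|\nabla f(y)-\nabla f(x)-\nabla^2 f(x)(y-x)\|$; for $x\ne y$, $\mathcal{H}_0(y,x)=2\mathcal{R}_0(y,x)/\|y-x\|^{2+\nu}$ and $\mathcal{H}_1(y,x)=\mathcal{R}_1(y,x)/\|y-x\|^{1+\nu}$. Subroutine CappedCG$(H,g,\zeta,\sigma)$ (Royer, O'Neill, Wright). Input: symmetric $H\in\mathbb{R}^{n\times n}$, $g\neq 0$, relative accuracy $\zeta\in(0,1)$, damping $\sigma>0$. Put $\bar H=H+2\sigma I$, $U=0$, and, always as functions of the current $U$, $\kappa=(U+2\sigma)/\sigma$, $\hat\zeta=\zeta/(3\kappa)$,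 $\tau=\sqrt\kappa/(\sqrt\kappa+1)$, $T=4\kappa^4/(1-\sqrt\tau)^2$. Start with $y^0=0$, $r^0=g$, $p^0=-g$, $j=0$. If $(p^0)^T\bar Hp^0<\sigma\|p^0\|^2$ return $(p^0,\mathrm{NC})$. Otherwise loop: $a_j=\|r^j\|^2/(p^j)^T\bar Hp^j$, $y^{j+1}=y^j+a_jp^j$, $r^{j+1}=r^j+a_j\bar Hp^j$, $b_{j+1}=\|r^{j+1}\|^2/\|r^j\|^2$, $p^{j+1}=-r^{j+1}+b_{j+1}p^j$; $j\leftarrow j+1$; replace $U$ by the maximum of $U$ and the ratios $\|Hv\|/\|v\|$ for $v\in\{p^0,p^j,y^j,r^j\}$, $v\neq0$; then: if $(y^j)^T\bar Hy^j<\sigma\|y^j\|^2$ return $(y^j,\mathrm{NC})$; else if $\|r^j\|\le\hat\zeta\|r^0\|$ return $(y^j,\mathrm{SOL})$; else if $(p^j)^T\bar Hp^j<\sigma\|p^j\|^2$ return $(p^j,\mathrm{NC})$; else if $\|r^j\|>\sqrt T\tau^{j/2}\|r^0\|$, compute $a_j=\|r^j\|^2/(p^j)^T\bar Hp^j$ and $y^{j+1}=y^j+a_jp^j$, find $i\in\{0,\dots,j-1\}$ with $(y^{j+1}-y^i)^T\bar H(y^{j+1}-y^i)<\sigma\|y^{j+1}-y^i\|^2$ and return $(y^{j+1}-y^i,\mathrm{NC})$. Known fact (Royer et al.): it returns an output $(d,\text{d\_type})$ such that, if d\_type $=$ SOL, $\sigma\|d\|^2\le d^T(H+2\sigma I)d$,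 $\|d\|\le1.1\sigma^{-1}\|g\|$, $d^Tg=-d^T(H+2\sigma I)d$, $\|(H+2\sigma I)d+g\|\le\zeta\sigma\|d\|/2$; and if d\_type $=$ NC, $d^Tg\le0$ and $d^THd/\|d\|^2<-\sigma$. Algorithm 1. Input: $x^0$, $\gamma_0\ge1$, $\eta,\theta\in(0,1)$, $\nu\in(0,1]$. For $k=0,1,\dots$ while $\nabla f(x^k)\ne0$: set $H_k=\nabla^2f(x^k)$, $g_k=\nabla f(x^k)$, $\varepsilon_k=(\gamma_k\|g_k\|^\nu)^{1/(1+\nu)}$, $\zeta_k=\min\{1/2,\|g_k\|^{\nu/(1+\nu)}\}$, and call CappedCG with matrix $H_k$, vector $g_k$, damping $\sigma=\varepsilon_k$ and accuracy $\zeta=\zeta_k$ to get $(d,\text{d\_type})$. If d\_type $=$ NC: $d^k=-\mathrm{sgn}(d^Tg_k)\frac{|d^TH_kd|}{\|d\|^3}d$; $\alpha_k=\theta^{j_k}$ with $j_k$ the smallest integer $j\ge0$ with $f(x^k+\theta^jd^k)<f(x^k)-\frac{\eta}{2}\theta^{2j}\|d^k\|^3$; if $j_k\ge1$ set $\sigma_k=\mathcal{H}_0(x^k+\theta^{j_k-1}d^k,x^k)$, and if $j_k=0$ set $\sigma_k=0$. If d\_type $=$ SOL: $d^k=d$; $\alpha_k=\theta^{j_k}$ with $j_k$ the smallest integer $j\ge0$ with $f(x^k+\theta^jd^k)<f(x^k)-\eta\varepsilon_k\theta^j\|d^k\|^2$; if $j_k=0$ set $\sigma_k=\mathcal{H}_1(x^k+d^k,x^k)$,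 otherwise $\sigma_k=\max\{\mathcal{H}_0(x^k+d^k,x^k),\mathcal{H}_0(x^k+\theta^{j_k-1}d^k,x^k)\}$. Then $x^{k+1}=x^k+\alpha_kd^k$, $\gamma_{k+1}=\max\{\gamma_k,\sigma_k\}$. *)

(* Defs.v *)
From HB Require Import structures.
From mathcomp Require Import all_boot all_order all_algebra.
From mathcomp Require Import all_classical all_reals all_analysis.
Set Implicit Arguments.
Unset Strict Implicit.
Unset Printing Implicit Defensive.
Import Order.TTheory GRing.Theory Num.Theory.
Import numFieldNormedType.Exports.
Local Open Scope classical_set_scope.
Local Open Scope ring_scope.

(* Points of R^n are column vectors. The library norm on ['cV[R]_n] is the sup
   norm, so the Euclidean norm is defined here; the library topology (used for
   compactness, differentiability, continuity and limits) is the usual one. *)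

Section Euclidean.
Context {R : realType}.

Definition dot n (u v : 'cV[R]_n) : R := (u^T *m v) 0 0.

Definition quad n (A : 'M[R]_n) (v : 'cV[R]_n) : R := (v^T *m A *m v) 0 0.

Definition norm2 n (v : 'cV[R]_n) : R := Num.sqrt (dot v v).

Definition spectral_norm m n (A : 'M[R]_(m, n)) : R :=
  sup [set norm2 (A *m v) | v in [set v : 'cV[R]_n | norm2 v <= 1]].

Definition eball n (c : 'cV[R]_n) (r : R) : set 'cV[R]_n :=
  [set y | norm2 (y - c) <= r].

(* Loewner order: A >= B *)
Definition loewner_ge n (A B : 'M[R]_n) : Prop :=
  forall v : 'cV[R]_n, 0 <= quad (A - B) v.

(* Unlike [Num.sg], takes the value 1 at 0. *)
Definition sgn (z : R) : R := if 0 <= z then 1 else -1.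

End Euclidean.

Section Calculus.
Context {R : realType} {n : nat}.
Implicit Types (f : 'cV[R]_n -> R) (x y u : 'cV[R]_n).

Definition grad f x : 'cV[R]_n := \col_i 'D_(delta_mx i 0) f x.

Definition hess f x : 'M[R]_n :=
  \matrix_(i, j) 'D_(delta_mx j 0) (fun y => grad f y i 0) x.

Definition twice_continuously_differentiable f : Prop :=
  [/\ forall x, differentiable f x,
      forall x, differentiable (grad f) x
    & continuous (hess f)].

Definition local_minimizer f x : Prop := \forall y \near x, f x <= f y.

Definition sublevel f u : set 'cV[R]_n := [set x | f x <= f u].

Definition sublevel_nbhd f u (r : R) : set 'cV[R]_n :=
  [set x | exists2 x', sublevel f u x' & norm2 (x - x') <= r].

Definition residual0 f y x : R :=
  `|f y - f x - dot (grad f x) (y - x) - quad (hess f x) (y - x) / 2|.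

Definition residual1 f y x : R :=
  norm2 (grad f y - grad f x - hess f x *m (y - x)).

(* The estimators are only meaningful for y != x (elsewhere they are 0). *)
Definition estimator0 (nu : R) f y x : R :=
  2 * residual0 f y x / norm2 (y - x) `^ (2 + nu).

Definition estimator1 (nu : R) f y x : R :=
  residual1 f y x / norm2 (y - x) `^ (1 + nu).

End Calculus.

Inductive d_type := SOL | NC.

Section CappedCG.
Context {R : realType} {n : nat}.
Variables (H : 'M[R]_n) (g : 'cV[R]_n) (zeta sigma : R).

Definition cg_Hbar : 'M[R]_n := H + (2 * sigma)%:M.

Record cg_state := CGState {
  cg_y : 'cV[R]_n; cg_r : 'cV[R]_n; cg_p : 'cV[R]_n; cg_U : R }.

Definition cg_kappa (U : R) : R := (U + 2 * sigma) / sigma.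
Definition cg_zetahat (U : R) : R := zeta / (3 * cg_kappa U).
Definition cg_tau (U : R) : R :=
  Num.sqrt (cg_kappa U) / (Num.sqrt (cg_kappa U) + 1).
Definition cg_T (U : R) : R :=
  4 * cg_kappa U ^+ 4 / (1 - Num.sqrt (cg_tau U)) ^+ 2.

Definition cg_update_U (U : R) (v : 'cV[R]_n) : R :=
  if v == 0 then U else Num.max U (norm2 (H *m v) / norm2 v).

Definition cg_init : cg_state := CGState 0 g (- g) 0.

Definition cg_steplength (s : cg_state) : R :=
  norm2 (cg_r s) ^+ 2 / quad cg_Hbar (cg_p s).

Definition cg_next_y (s : cg_state) : 'cV[R]_n :=
  cg_y s + cg_steplength s *: cg_p s.

Definition cg_next (s : cg_state) : cg_state :=
  let y' := cg_next_y s in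
  let r' := cg_r s + cg_steplength s *: (cg_Hbar *m cg_p s) in
  let b' := norm2 r' ^+ 2 / norm2 (cg_r s) ^+ 2 in
  let p' := - r' + b' *: cg_p s in
  CGState y' r' p' (foldl cg_update_U (cg_U s) [:: cg_p cg_init; p'; y'; r']).

(* The state of the loop after j passes, ignoring the exit tests. *)
Definition cg_iter (j : nat) : cg_state := iter j cg_next cg_init.

Definition cg_negcurv (v : 'cV[R]_n) : bool :=
  quad cg_Hbar v < sigma * norm2 v ^+ 2.

Definition cg_solved (j : nat) : bool :=
  let s := cg_iter j in
  norm2 (cg_r s) <= cg_zetahat (cg_U s) * norm2 (cg_r cg_init).

Definition cg_slow (j : nat) : bool :=
  let s := cg_iter j in
  norm2 (cg_r s) >
    Num.sqrt (cg_T (cg_U s)) * cg_tau (cg_U s) `^ (j%:R / 2)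
      * norm2 (cg_r cg_init).

(* No exit test succeeds at j; at j = 0 the initial direction is the only thing
   that is tested. *)
Definition cg_continue (j : nat) : bool :=
  if j == 0%N then ~~ cg_negcurv (cg_p cg_init) else
  [&& ~~ cg_negcurv (cg_y (cg_iter j)), ~~ cg_solved j,
      ~~ cg_negcurv (cg_p (cg_iter j)) & ~~ cg_slow j].

Definition cg_reached (j : nat) : Prop :=
  (0 < j)%N /\ forall i, (i < j)%N -> cg_continue i.

(* A relation rather than a function, because the index i of the last exit is
   not specified uniquely. *)
Inductive capped_cg : 'cV[R]_n -> d_type -> Prop :=
| CG_init_NC :
    cg_negcurv (cg_p cg_init) ->
    capped_cg (cg_p cg_init) NC
| CG_y_NC j :
    cg_reached j -> cg_negcurv (cg_y (cg_iter j)) ->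
    capped_cg (cg_y (cg_iter j)) NC
| CG_y_SOL j :
    cg_reached j -> ~~ cg_negcurv (cg_y (cg_iter j)) -> cg_solved j ->
    capped_cg (cg_y (cg_iter j)) SOL
| CG_p_NC j :
    cg_reached j -> ~~ cg_negcurv (cg_y (cg_iter j)) -> ~~ cg_solved j ->
    cg_negcurv (cg_p (cg_iter j)) ->
    capped_cg (cg_p (cg_iter j)) NC
| CG_slow_NC j i :
    cg_reached j -> ~~ cg_negcurv (cg_y (cg_iter j)) -> ~~ cg_solved j ->
    ~~ cg_negcurv (cg_p (cg_iter j)) -> cg_slow j ->
    (i < j)%N ->
    cg_negcurv (cg_next_y (cg_iter j) - cg_y (cg_iter i)) ->
    capped_cg (cg_next_y (cg_iter j) - cg_y (cg_iter i)) NC.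

End CappedCG.

Definition smallest (P : nat -> Prop) (j : nat) : Prop :=
  P j /\ forall i, (i < j)%N -> ~ P i.

Section NewtonCG.
Context {R : realType} {n : nat}.
Variables (f : 'cV[R]_n -> R) (nu eta theta : R).

(* One pass of the main loop, from (x^k, gamma_k) to (x^(k+1), gamma_(k+1)). *)
Definition newton_cg_step (x : 'cV[R]_n) (gamma : R)
    (x' : 'cV[R]_n) (gamma' : R) : Prop :=
  let g := grad f x in
  let H := hess f x in
  let eps := (gamma * norm2 g `^ nu) `^ (1 + nu)^-1 in
  let zeta := Num.min (1 / 2) (norm2 g `^ (nu / (1 + nu))) in
  g != 0 /\
  exists (d : 'cV[R]_n) (t : d_type), capped_cg H g zeta eps d t /\
  match t with
  | NC =>
      let dk := - (sgn (dot d g) * (`|quad H d| / norm2 d ^+ 3)) *: d in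
      exists j : nat,
      [/\ smallest (fun i => f (x + theta ^+ i *: dk) <
            f x - eta / 2 * theta ^+ (2 * i) * norm2 dk ^+ 3) j,
          x' = x + theta ^+ j *: dk
        & gamma' = Num.max gamma
            (if j is i.+1 then estimator0 nu f (x + theta ^+ i *: dk) x else 0)]
  | SOL =>
      exists j : nat,
      [/\ smallest (fun i => f (x + theta ^+ i *: d) <
            f x - eta * eps * theta ^+ i * norm2 d ^+ 2) j,
          x' = x + theta ^+ j *: d
        & gamma' = Num.max gamma
            (if j is i.+1 then
               Num.max (estimator0 nu f (x + d) x)
                       (estimator0 nu f (x + theta ^+ i *: d) x)
             else estimator1 nu f (x + d) x)]
  end.

(* The iterates x 0, ..., x k have been produced by the algorithm. Since a pass
   requires a nonzero gradient, after termination no further index is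
   generated, and the values of [x] and [gamma] there are arbitrary. *)
Definition generated (x0 : 'cV[R]_n) (gamma0 : R)
    (x : nat -> 'cV[R]_n) (gamma : nat -> R) (k : nat) : Prop :=
  [/\ x 0%N = x0, gamma 0%N = gamma0
    & forall i, (i < k)%N ->
        newton_cg_step (x i) (gamma i) (x i.+1) (gamma i.+1)].

End NewtonCG.

(* Main.v *)
Require Import Defs.
From HB Require Import structures.
From mathcomp Require Import all_boot all_order all_algebra.
From mathcomp Require Import all_classical all_reals all_analysis.
From mathcomp Require Import ring lra.
Import Order.TTheory GRing.Theory Num.Theory.
Import numFieldNormedType.Exports.
Local Open Scope classical_set_scope.
Local Open Scope ring_scope.

(** Near [xs] the Hessian is bounded below by a multiple of [mu], so no vector of
    small curvature exists there: every exit of the inner solver that reports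
    negative curvature is impossible ([capped_cg_NC_negcurv]) and each outer step
    solves the damped Newton equation [(H + 2 eps I) d = - g] up to a small residual.
    For such a step the unit step length passes the sufficient decrease test
    ([SOL_unit_step_accepted]), because in the second order Taylor formula the
    variation of the Hessian is absorbed by the curvature [mu].  The error of the next
    iterate is then Newton's remainder, of order [e^(1 + nu)] in the current
    error [e], plus the perturbation [eps * norm2 d] due to damping
    ([SOL_unit_step_error]).  Both the gradient and the step are of order [e], so
    that [eps] is of order [(gamma e^nu)^(1 / (1 + nu))] and the perturbation is of
    order [e^(1 + nu / (1 + nu))] ([newton_cg_local_step]).

    The constant hidden in this estimate involves [gamma], which changes along the
    run, whereas the radius [delta] has to be chosen beforehand.  This is settled by a
    global bound ([generated_bounds]): the iterates never leave the sublevel set of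
    [x0], all trial points lie within the distance [r_d] of it, and there the local
    estimators are at most the Hölder constant; hence [gamma] never exceeds
    [Num.max gamma0 Hf].

    The estimates for the inner solver rest on the identity [r = Hbar y + g]
    ([cg_residual]), on the exit tests and on the fact that [U] dominates the ratio of
    the norms of [H *m y] and [y].  The residual test is relative to [norm2 g], and
    [kappa] turns it into a test relative to the step ([capped_cg_SOL]).

    Finally, a local minimizer outside the sublevel set of [x0] is never approached,
    because the objective stays above [f x0] near it. *)

(** * Euclidean and spectral norms *)

Section EuclideanTheory.
Context {R : realType} {n : nat}.
Implicit Types (u v w : 'cV[R]_n) (A B : 'M[R]_n).

Lemma dotE u v : dot u v = \sum_i u i 0 * v i 0.
Proof. by rewrite /dot mxE; apply: eq_bigr => i _; rewrite mxE. Qed.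

Lemma dotC u v : dot u v = dot v u.
Proof. by rewrite !dotE; apply: eq_bigr => i _; rewrite mulrC. Qed.

Lemma dotDr u v w : dot u (v + w) = dot u v + dot u w.
Proof. by rewrite /dot mulmxDr mxE. Qed.

Lemma dotZr (c : R) u v : dot u (c *: v) = c * dot u v.
Proof. by rewrite /dot -scalemxAr mxE. Qed.

Lemma dotNr u v : dot u (- v) = - dot u v.
Proof. by rewrite -scaleN1r dotZr mulN1r. Qed.

Lemma dotBr u v w : dot u (v - w) = dot u v - dot u w.
Proof. by rewrite dotDr dotNr. Qed.

Lemma dotBl u v w : dot (v - w) u = dot v u - dot w u.
Proof. by rewrite dotC dotBr !(dotC u). Qed.

Lemma dotDl u v w : dot (v + w) u = dot v u + dot w u.
Proof. by rewrite dotC dotDr !(dotC u). Qed.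

Lemma dotZl (c : R) u v : dot (c *: u) v = c * dot u v.
Proof. by rewrite dotC dotZr dotC. Qed.

Lemma dot_ge0 u : 0 <= dot u u.
Proof. by rewrite dotE sumr_ge0 // => i _; rewrite -expr2 sqr_ge0. Qed.

Lemma norm2_ge0 u : 0 <= norm2 u.
Proof. exact: sqrtr_ge0. Qed.

Lemma sqr_norm2 u : norm2 u ^+ 2 = dot u u.
Proof. by rewrite sqr_sqrtr // dot_ge0. Qed.

Lemma norm2_eq0 u : (norm2 u == 0) = (u == 0).
Proof.
apply/eqP/eqP => [u0|->]; last by rewrite /norm2 /dot mulmx0 mxE sqrtr0.
have : dot u u == 0 by rewrite -sqr_norm2 u0 expr0n.
rewrite dotE psumr_eq0 => [/allP h|i _]; last by rewrite -expr2 sqr_ge0.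
apply/matrixP => i j; rewrite ord1 mxE; apply/eqP.
by have := h i (mem_index_enum _); rewrite mulf_eq0 orbb.
Qed.

Lemma norm2_0 : norm2 (0 : 'cV[R]_n) = 0.
Proof. by apply/eqP; rewrite norm2_eq0. Qed.

Lemma norm2_gt0 u : (0 < norm2 u) = (u != 0).
Proof. by rewrite lt_neqAle norm2_ge0 andbT eq_sym norm2_eq0. Qed.

Lemma norm2Z (c : R) u : norm2 (c *: u) = `|c| * norm2 u.
Proof.
by rewrite /norm2 dotZl dotZr mulrA -expr2 sqrtrM ?sqr_ge0 // sqrtr_sqr.
Qed.

Lemma norm2N u : norm2 (- u) = norm2 u.
Proof. by rewrite -scaleN1r norm2Z normrN1 mul1r. Qed.

Lemma norm2BC u v : norm2 (u - v) = norm2 (v - u).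
Proof. by rewrite -norm2N opprB. Qed.

Lemma cauchy_schwarz u v : `|dot u v| <= norm2 u * norm2 v.
Proof.
have [->|v0] := eqVneq v 0.
  by rewrite /dot mulmx0 mxE normr0 mulr_ge0 ?norm2_ge0.
have v2 : 0 < dot v v by rewrite -sqr_norm2 exprn_gt0 // norm2_gt0.
have : 0 <= dot (dot v v *: u - dot u v *: v) (dot v v *: u - dot u v *: v).
  exact: dot_ge0.
rewrite !(dotBl, dotBr, dotZl, dotZr) (dotC v u).
rewrite (_ : _ - _ = dot v v * (dot u u * dot v v - dot u v ^+ 2)); last by ring.
rewrite pmulr_rge0 // subr_ge0 => h.
rewrite -(@ler_pXn2r _ 2) ?nnegrE ?mulr_ge0 ?norm2_ge0 //.
by rewrite real_normK ?num_real // exprMn !sqr_norm2.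
Qed.

Lemma dot_le u v : dot u v <= norm2 u * norm2 v.
Proof. exact: le_trans (ler_norm _) (cauchy_schwarz _ _). Qed.

Lemma norm2D u v : norm2 (u + v) <= norm2 u + norm2 v.
Proof.
rewrite -(@ler_pXn2r _ 2) ?nnegrE ?addr_ge0 ?norm2_ge0 //.
rewrite sqr_norm2 dotDl !dotDr (dotC v u) sqrrD !sqr_norm2.
have := dot_le u v; lra.
Qed.

Lemma norm2B u v : norm2 (u - v) <= norm2 u + norm2 v.
Proof. by rewrite -(norm2N v) norm2D. Qed.

Lemma quadE A v : quad A v = dot v (A *m v).
Proof. by rewrite /quad /dot mulmxA. Qed.

Lemma quadB A B v : quad (A - B) v = quad A v - quad B v.
Proof. by rewrite !quadE mulmxBl dotBr. Qed.

Lemma quad_scalar (c : R) v : quad c%:M v = c * norm2 v ^+ 2.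
Proof. by rewrite quadE mul_scalar_mx dotZr sqr_norm2. Qed.

(** The Frobenius norm is an upper bound, by Cauchy-Schwarz on each row. *)
Lemma has_sup_spectral_norm A :
  has_sup [set norm2 (A *m v) | v in [set v : 'cV[R]_n | norm2 v <= 1]].
Proof.
split; first by exists (norm2 (A *m 0)); exists 0 => //=; rewrite norm2_0 ler01.
exists (Num.sqrt (\sum_i norm2 (row i A)^T ^+ 2)) => _ [v /= v1 <-].
rewrite ler_sqrt; last by rewrite sumr_ge0 // => i _; rewrite sqr_ge0.
rewrite dotE ler_sum // => i _.
have -> : (A *m v) i 0 = dot (row i A)^T v.
  by rewrite /dot trmxK -row_mul [RHS]mxE.
rewrite -expr2 -real_normK ?num_real // ler_pXn2r ?nnegrE ?norm2_ge0 //.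
by apply: le_trans (cauchy_schwarz _ _) _; rewrite ler_piMr ?norm2_ge0.
Qed.

Lemma norm2_mulmx A v : norm2 (A *m v) <= spectral_norm A * norm2 v.
Proof.
have [->|v0] := eqVneq v 0; first by rewrite mulmx0 norm2_0 mulr0.
have v1 : 0 < norm2 v by rewrite norm2_gt0.
rewrite -ler_pdivrMr //; apply: ub_le_sup; first exact: (has_sup_spectral_norm A).2.
exists ((norm2 v)^-1 *: v) => /=.
  by rewrite norm2Z gtr0_norm ?invr_gt0 // mulVf ?gt_eqF.
by rewrite -scalemxAr norm2Z gtr0_norm ?invr_gt0 // mulrC.
Qed.

Lemma spectral_norm_ge0 A : 0 <= spectral_norm A.
Proof.
apply: le_trans (norm2_ge0 (A *m 0)) _.
apply: ub_le_sup; first exact: (has_sup_spectral_norm A).2.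
by exists 0 => //=; rewrite norm2_0 ler01.
Qed.

Lemma norm_quad A v : `|quad A v| <= spectral_norm A * norm2 v ^+ 2.
Proof.
rewrite quadE expr2 mulrA; apply: le_trans (cauchy_schwarz _ _) _.
by rewrite mulrC ler_pM ?norm2_ge0 // norm2_mulmx.
Qed.

(** Comparison with the sup norm, which carries the topology. *)
Lemma norm_le_norm2 v : `|v| <= norm2 v.
Proof.
rewrite [leLHS]mx_normrE; apply: bigmax_le => [|[i j] _]; first exact: norm2_ge0.
rewrite ord1 /= -(@ler_pXn2r _ 2) ?nnegrE ?norm2_ge0 // real_normK ?num_real //.
rewrite sqr_norm2 dotE (bigD1 i) //= -expr2 lerDl sumr_ge0 // => k _.
by rewrite -expr2 sqr_ge0.
Qed.

End EuclideanTheory.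

(** * Second order Taylor formula *)

Section Taylor.
Context {R : realType}.

(** Two applications of Rolle's theorem, the first one to the defect of the quadratic
    interpolant of [phi] with the value and slope at 0 and the value at 1. *)
Lemma taylor2_lagrange (phi phi1 phi2 : R -> R) :
  (forall t : R, is_derive t 1 phi (phi1 t)) ->
  (forall t : R, is_derive t 1 phi1 (phi2 t)) ->
  exists2 t, 0 <= t <= 1 & phi 1 = phi 0 + phi1 0 + phi2 t / 2.
Proof.
move=> d1 d2; pose K := 2 * (phi 1 - phi 0 - phi1 0).
pose sq : R -> R := (id : R -> R) ^+ 2.
(* K makes G vanish at 1 as it does at 0; Rolle then gives a zero of the derivative
   G1, which also vanishes at 0 *)
pose G : R -> R := phi - phi1 0 \*: (id : R -> R) - (K / 2) \*: sq.
pose G1 : R -> R := phi1 - cst (phi1 0) - K \*: (id : R -> R).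
have GE t : G t = phi t - phi1 0 * t - K / 2 * t ^+ 2 by [].
have G1E t : G1 t = phi1 t - phi1 0 - K * t by [].
have dsq (t : R) : is_derive t 1 sq (2 * t).
  by apply: is_derive_eq; rewrite /GRing.scale /= mulr1 expr1.
have dG (t : R) : is_derive t 1 G (G1 t).
  by rewrite /G; apply: is_derive_eq; rewrite G1E /GRing.scale /=; lra.
have dG1 (t : R) : is_derive t 1 G1 (phi2 t - K).
  by rewrite /G1; apply: is_derive_eq; rewrite /GRing.scale /=; lra.
have cont (F F' : R -> R) (a b : R) :
    (forall t : R, is_derive t 1 F (F' t)) -> {within `[a, b], continuous F}.
  move=> dF; apply: continuous_subspaceT => t.
  by apply/differentiable_continuous/derivable1_diffP; case: (dF t).
have [||||c cI dc] := @Rolle R G 0 1.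
- exact: ltr01.
- by move=> t _; case: (dG t).
- exact: cont dG.
- by rewrite !GE /K; lra.
have c0 : 0 < c by rewrite (itvP cI).
have G1c : G1 c = 0 by rewrite -(derive_val (is_derive := dG c)) derive_val.
have [||||t tI dt] := @Rolle R G1 0 c.
- exact: c0.
- by move=> t _; case: (dG1 t).
- exact: cont dG1.
- by rewrite G1c G1E; lra.
have H : phi2 t - K = 0 by rewrite -(derive_val (is_derive := dG1 t)) derive_val.
exists t; last by rewrite /K in H; lra.
rewrite ltW ?(itvP tI) //=; apply: (le_trans (y := c)); apply: ltW.
  by rewrite (itvP tI).
by rewrite (itvP cI).
Qed.

End Taylor.

(** * Derivatives along lines *)

Section LineDerivatives.
Context {R : realType} {n : nat}.
Implicit Types (f : 'cV[R]_n -> R) (x h w : 'cV[R]_n).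

(** The difference quotients of the restriction to a line are those of [f] in the
    direction [h]. *)
Lemma is_derive_line f x h (t : R) : differentiable f (x + t *: h) ->
  is_derive t 1 (fun s => f (x + s *: h)) ('D_h f (x + t *: h)).
Proof.
move=> df.
have e : (fun k : R => k^-1 *: (((fun s => f (x + s *: h)) \o shift t) (k *: 1)
      - f (x + t *: h)))
  = (fun k => k^-1 *: ((f \o shift (x + t *: h)) (k *: h) - f (x + t *: h))).
  apply/funext => k /=; congr (_ *: (f _ - _)).
  by rewrite [k%:A]mulr1 scalerDl addrCA.
by split; [have := diff_derivable (v := h) df|]; rewrite /derivable /derive e.
Qed.

Lemma derive_coord f x h : differentiable f x ->
  'D_h f x = \sum_i h i 0 * 'D_(delta_mx i 0) f x.
Proof.
move=> df; rewrite deriveE // {1}(matrix_sum_delta h) linear_sum.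
by apply: eq_bigr => i _; rewrite big_ord1 linearZ /= deriveE.
Qed.

Lemma derive_grad f x h : differentiable f x -> 'D_h f x = dot h (grad f x).
Proof.
by move=> df; rewrite derive_coord // dotE; apply: eq_bigr => i _; rewrite mxE.
Qed.

Lemma is_derive_grad f x h w (t : R) :
  differentiable (grad f) (x + t *: h) ->
  is_derive t 1 (fun s => dot w (grad f (x + s *: h)))
    (dot w (hess f (x + t *: h) *m h)).
Proof.
move=> dg.
have dgi i : differentiable (fun y : 'cV[R]_n => grad f y i 0 : R) (x + t *: h).
  exact: (differentiable_comp dg (differentiable_coord _ _ _)).
have -> : (fun s => dot w (grad f (x + s *: h)))
    = \sum_i (w i 0 \*: (fun s => grad f (x + s *: h) i 0)).
  by apply/funext => s; rewrite dotE fct_sumE.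
rewrite dotE; apply: is_derive_sum => i; apply: is_deriveZ.
have := is_derive_line _ _ _ _ (dgi i); rewrite derive_coord //.
congr (is_derive _ _ _ _); rewrite mxE; apply: eq_bigr => j _.
by rewrite mxE mulrC.
Qed.
End LineDerivatives.

(** * Taylor residuals and Hölder estimators *)

Section Residuals.
Context {R : realType} {n : nat}.
Implicit Types (f : 'cV[R]_n -> R) (x y h w : 'cV[R]_n).

Lemma taylor2_line f x h : twice_continuously_differentiable f ->
  exists2 t, 0 <= t <= 1 &
    f (x + h) = f x + dot (grad f x) h + quad (hess f (x + t *: h)) h / 2.
Proof.
move=> [df dg _].
have [t||t tI] := @taylor2_lagrange R (fun s => f (x + s *: h))
    (fun s => dot h (grad f (x + s *: h)))
    (fun s => dot h (hess f (x + s *: h) *m h)).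
- by rewrite -derive_grad //; apply: is_derive_line.
- by move=> t; apply: is_derive_grad.
rewrite scale1r scale0r addr0 => ->; exists t => //.
by rewrite quadE (dotC h (grad f x)).
Qed.

Lemma mean_value_grad f x h w : twice_continuously_differentiable f ->
  exists2 t, 0 <= t <= 1 &
    dot w (grad f (x + h) - grad f x) = dot w (hess f (x + t *: h) *m h).
Proof.
move=> [_ dg _].
have dG (t : R) := is_derive_grad _ _ _ w _ (dg (x + t *: h)).
have [|t tI] := @MVT R _ _ 0 1 ltr01 (fun t _ => dG t).
  apply: continuous_subspaceT => t.
  by apply/differentiable_continuous/derivable1_diffP; case: (dG t).
rewrite scale1r scale0r addr0 subr0 mulr1 => e; exists t.
  by rewrite !ltW ?(itvP tI).
by rewrite dotBr.
Qed.

(** [L] may be any bound for the variation of the Hessian along the segment; the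
    Hölder condition gives [Hf * norm2 h `^ nu]. *)
Lemma residual0_le f x h (L : R) : twice_continuously_differentiable f ->
  (forall t, 0 <= t <= 1 ->
     spectral_norm (hess f (x + t *: h) - hess f x) <= L) ->
  residual0 f (x + h) x <= L / 2 * norm2 h ^+ 2.
Proof.
move=> f2 hL; have [t tI e] := taylor2_line _ x h f2.
rewrite /residual0 (_ : x + h - x = h); last by rewrite addrAC subrr add0r.
rewrite (_ : f (x + h) - _ - _ - _
    = quad (hess f (x + t *: h) - hess f x) h / 2); last first.
  rewrite e quadB; move: (f x) (dot _ _) (quad _ _) (quad _ _) => a b c d; lra.
rewrite normrM (ger0_norm (x := 2^-1)) // mulrAC ler_pM2r ?invr_gt0 //.
apply: le_trans (norm_quad _ _) _; apply: ler_wpM2r; last exact: hL.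
by rewrite sqr_ge0.
Qed.

(** The mean value theorem is applied to the component of the gradient along the
    residual vector itself, there being no mean value theorem for vectors. *)
Lemma residual1_le f x h (L : R) : twice_continuously_differentiable f ->
  (forall t, 0 <= t <= 1 ->
     spectral_norm (hess f (x + t *: h) - hess f x) <= L) ->
  residual1 f (x + h) x <= L * norm2 h.
Proof.
move=> f2 hL; rewrite /residual1 (_ : x + h - x = h); last first.
  by rewrite addrAC subrr add0r.
set w := _ - _ *m _; have [t tI e] := mean_value_grad _ x h w f2.
have {}hL := hL t tI; have L0 := le_trans (spectral_norm_ge0 _) hL.
have [->|w0] := eqVneq w 0; first by rewrite norm2_0 mulr_ge0 ?norm2_ge0.
rewrite -(@ler_pM2l _ (norm2 w)) ?norm2_gt0 // -expr2 sqr_norm2.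
rewrite {2}/w dotBr e -dotBr -mulmxBl; apply: le_trans (dot_le _ _) _.
apply: ler_wpM2l; first exact: norm2_ge0.
by apply: le_trans (norm2_mulmx _ _) _; apply: ler_wpM2r; rewrite ?norm2_ge0.
Qed.

(** The powers in the estimators are those for which a Hölder constant is an upper
    bound.  The degenerate case [h = 0] holds because the quotient is then 0. *)
Lemma estimator0_le f x h (nu c : R) : twice_continuously_differentiable f ->
  0 < nu -> 0 <= c ->
  (forall t, 0 <= t <= 1 ->
     spectral_norm (hess f (x + t *: h) - hess f x) <= c * norm2 h `^ nu) ->
  estimator0 nu f (x + h) x <= c.
Proof.
move=> f2 nu0 c0 /(residual0_le _ _ _ _ f2) hr; rewrite /estimator0.
rewrite (_ : x + h - x = h); last by rewrite addrAC subrr add0r.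
have [h0|h0] := eqVneq h 0.
  by rewrite h0 norm2_0 powR0 ?invr0 ?mulr0 // gt_eqF // addr_gt0.
have hp : 0 < norm2 h by rewrite norm2_gt0.
rewrite ler_pdivrMr ?powR_gt0 // powRD ?(gt_eqF hp) ?implybT //.
by rewrite powR_mulrn ?norm2_ge0 //; lra.
Qed.

Lemma estimator1_le f x h (nu c : R) : twice_continuously_differentiable f ->
  0 < nu -> 0 <= c ->
  (forall t, 0 <= t <= 1 ->
     spectral_norm (hess f (x + t *: h) - hess f x) <= c * norm2 h `^ nu) ->
  estimator1 nu f (x + h) x <= c.
Proof.
move=> f2 nu0 c0 /(residual1_le _ _ _ _ f2) hr; rewrite /estimator1.
rewrite (_ : x + h - x = h); last by rewrite addrAC subrr add0r.
have [h0|h0] := eqVneq h 0.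
  by rewrite h0 norm2_0 powR0 ?invr0 ?mulr0 // gt_eqF // addr_gt0.
have hp : 0 < norm2 h by rewrite norm2_gt0.
rewrite ler_pdivrMr ?powR_gt0 // powRD ?(gt_eqF hp) ?implybT //.
by rewrite powRr1 ?norm2_ge0 //; lra.
Qed.

(** Fermat, applied to the restriction of [f] to each coordinate line. *)
Lemma grad_local_minimizer f x : twice_continuously_differentiable f ->
  local_minimizer f x -> grad f x = 0.
Proof.
move=> [df _ _] minx; apply/matrixP => i j; rewrite ord1 [RHS]mxE mxE.
set v := delta_mx i 0.
have cl : (x + (t : R) *: v) @[t --> 0] --> x.
  rewrite -[X in _ --> X]addr0 -[X in _ --> x + X](scale0r v).
  by apply: cvgD; [exact: cvg_cst|apply: cvgZr_tmp; exact: cvg_id].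
have /nbhs_ballP[e /= e0 he] := cl _ minx.
have dphi (t : R) := is_derive_line _ _ v _ (df (x + t *: v)).
have min0 : is_derive (0 : R) 1 (fun t => f (x + t *: v)) 0.
  apply: (@derive1_at_min R _ (- e) e).
  - by rewrite ge0_cp // ltW.
  - by move=> t _; case: (dphi t).
  - by rewrite in_itv /= oppr_lt0 e0.
  - move=> t; rewrite in_itv /= => tI; rewrite scale0r addr0; apply: he.
    by rewrite /ball /= sub0r normrN ltr_norml.
have [_ <-] := min0; have [_] := dphi 0.
by rewrite scale0r addr0 => ->.
Qed.

End Residuals.

(** * Outputs of the capped conjugate gradient method *)

Section CappedCGTheory.
Context {R : realType} {n : nat}.
Variables (H : 'M[R]_n) (g : 'cV[R]_n) (zeta sigma : R).
Hypotheses (sigma_gt0 : 0 < sigma) (zeta_ge0 : 0 <= zeta) (zeta_le : zeta <= 1 / 2).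

Lemma cg_residual j :
  cg_r (cg_iter H g sigma j) = cg_Hbar H sigma *m cg_y (cg_iter H g sigma j) + g.
Proof.
elim: j => [|j IH]; first by rewrite /cg_iter /= mulmx0 add0r.
rewrite /cg_iter iterS -/(cg_iter _ _ _ j) /cg_next /= IH /cg_next_y mulmxDr.
by rewrite -scalemxAr addrAC.
Qed.

Lemma cg_update_U_ge U v : U <= cg_update_U H U v.
Proof. by rewrite /cg_update_U; case: ifP => // _; rewrite le_max lexx. Qed.

Lemma cg_update_U_mulmx U v :
  norm2 (H *m v) <= cg_update_U H U v * norm2 v.
Proof.
rewrite /cg_update_U; case: eqVneq => [->|v0].
  by rewrite mulmx0 norm2_0 mulr0.
by rewrite -ler_pdivrMr ?norm2_gt0 // le_max lexx orbT.
Qed.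

Lemma cg_U_ge0 j : 0 <= cg_U (cg_iter H g sigma j).
Proof.
elim: j => [|j IH] //; rewrite /cg_iter iterS -/(cg_iter _ _ _ j) /cg_next /=.
by do 4!apply: le_trans (cg_update_U_ge _ _).
Qed.

Lemma cg_U_mulmx j : (0 < j)%N ->
  norm2 (H *m cg_y (cg_iter H g sigma j))
    <= cg_U (cg_iter H g sigma j) * norm2 (cg_y (cg_iter H g sigma j)).
Proof.
case: j => // j _; rewrite /cg_iter iterS -/(cg_iter _ _ _ j) /cg_next /=.
apply: le_trans (cg_update_U_mulmx _ _) _; apply: ler_wpM2r (cg_update_U_ge _ _).
exact: norm2_ge0.
Qed.

(** With [G], [r] and [d] the norms of gradient, residual and step, the exit test reads
    [r <= zeta * G / (3 * kappa)].  As [kappa >= 2] this makes [r <= G / 12].  The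
    update of [U] at [y] gives [G <= r + kappa * sigma * d], hence
    [G <= 12 / 11 * kappa * sigma * d], and [kappa] cancels in the test. *)
Lemma capped_cg_SOL d : capped_cg H g zeta sigma d SOL ->
  [/\ sigma * norm2 d ^+ 2 <= quad (cg_Hbar H sigma) d,
      norm2 (cg_Hbar H sigma *m d + g) <= norm2 g / 12
    & norm2 (cg_Hbar H sigma *m d + g) <= zeta * sigma * norm2 d / 2].
Proof.
move=> hd; inversion hd as [| |j reached curv sol dE dt| |].
have {reached dt}[j0 _] := reached.
have res := cg_residual j; rewrite dE in curv res *; rewrite -res.
move: sol; rewrite /cg_solved /= /cg_zetahat.
set r := norm2 (cg_r _); set U := cg_U _; move=> sol.
have U0 : 0 <= U := cg_U_ge0 j.
have Hd : norm2 (cg_Hbar H sigma *m d) <= (U + 2 * sigma) * norm2 d.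
  rewrite /cg_Hbar mulmxDl mul_scalar_mx; apply: le_trans (norm2D _ _) _.
  rewrite norm2Z ger0_norm; last by rewrite mulr_ge0 // ltW.
  rewrite [leRHS]mulrDl lerD2r; have := cg_U_mulmx _ j0; by rewrite dE.
have k2 : 2 <= cg_kappa sigma U by rewrite /cg_kappa ler_pdivlMr //; lra.
have kE : U + 2 * sigma = cg_kappa sigma U * sigma.
  by rewrite /cg_kappa divfK // gt_eqF.
move: sol Hd; rewrite kE; set k := cg_kappa _ _ in k2 *.
set G := norm2 g => sol Hd.
have G0 : 0 <= G := norm2_ge0 _.
have k0 : 0 < k by lra.
have GE : G <= r + k * sigma * norm2 d.
  apply: le_trans (lerD (lexx r) Hd).
  rewrite /G -{1}(addrK (cg_Hbar H sigma *m d) g).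
  by rewrite /r res (addrC _ g); apply: norm2B.
have r0 : 0 <= r := norm2_ge0 _.
have sol' : 3 * (k * r) <= zeta * G.
  move: sol; rewrite mulrAC ler_pdivlMr; last by lra.
  by rewrite mulrC mulrA.
have r12 : r <= G / 12.
  have := ler_wpM2r r0 k2; have := ler_wpM2r G0 zeta_le; lra.
split => //; first by rewrite leNgt.
have d0 : 0 <= sigma * norm2 d by rewrite mulr_ge0 ?norm2_ge0 // ltW.
rewrite -(ler_pM2l k0) -(mulrA zeta); move: GE; rewrite -(mulrA k).
move: (sigma * _) d0 => s s0 GE.
have zks : 0 <= zeta * (k * s) by exact: mulr_ge0 zeta_ge0 (mulr_ge0 (ltW k0) s0).
have : 11 * (zeta * G) <= 12 * (zeta * (k * s)).
  by rewrite (mulrCA 11) (mulrCA 12); apply: (ler_wpM2l zeta_ge0); lra.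
rewrite (_ : k * (_ / 2) = zeta * (k * s) / 2); last by ring.
lra.
Qed.

(** From [Hbar d = r - g] and [norm2 r <= norm2 g / 12]: 13/12 is below 11/10. *)
Lemma capped_cg_SOL_quad d : capped_cg H g zeta sigma d SOL ->
  quad (cg_Hbar H sigma) d <= 11 / 10 * norm2 g * norm2 d.
Proof.
move=> /capped_cg_SOL[_]; set r := _ *m d + g => hr _.
rewrite quadE (_ : _ *m d = r - g); last by rewrite addrK.
apply: le_trans (dot_le _ _) _; rewrite mulrC; apply: ler_wpM2r.
  exact: norm2_ge0.
have := norm2B r g; have := norm2_ge0 g.
move: (norm2 g) (norm2 r) (norm2 (r - g)) hr => a b c; lra.
Qed.

Lemma capped_cg_SOL_norm d : capped_cg H g zeta sigma d SOL ->
  sigma * norm2 d <= 11 / 10 * norm2 g.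
Proof.
move=> hd; have [h _ _] := capped_cg_SOL _ hd; have := capped_cg_SOL_quad _ hd.
have [->|d0] := eqVneq d 0.
  by move=> _; rewrite norm2_0 mulr0 mulr_ge0 ?norm2_ge0.
move=> /(le_trans h); rewrite expr2 mulrA ler_pM2r // norm2_gt0 //.
Qed.

(** Each such exit exhibits its direction; on a positive definite matrix
    none of them can be taken. *)
Lemma capped_cg_NC_negcurv d : capped_cg H g zeta sigma d NC ->
  exists v : 'cV[R]_n, cg_negcurv H sigma v.
Proof. by move=> hd; inversion hd; eexists; eassumption. Qed.

End CappedCGTheory.

(** * Bounds along the whole run *)

Section GlobalBounds.
Context {R : realType} {n : nat}.
Variables (f : 'cV[R]_n -> R) (x0 : 'cV[R]_n) (nu eta theta Ug UH Hf rd : R).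
Hypotheses (f_C2 : twice_continuously_differentiable f)
  (grad_le : forall x, sublevel f x0 x -> norm2 (grad f x) <= Ug)
  (hess_le : forall x, sublevel f x0 x -> spectral_norm (hess f x) <= UH)
  (nu_gt0 : 0 < nu) (Hf_ge0 : 0 <= Hf)
  (rd_ge : 11 / 10 <= rd) (rd_geUg : 11 / 10 * Ug <= rd) (rd_geUH : UH <= rd)
  (hess_holder : forall x y,
     sublevel_nbhd f x0 rd x -> sublevel_nbhd f x0 rd y ->
     spectral_norm (hess f y - hess f x) <= Hf * norm2 (y - x) `^ nu)
  (eta_gt0 : 0 < eta) (theta_gt0 : 0 < theta) (theta_lt1 : theta < 1).
Implicit Types x d h : 'cV[R]_n.

Lemma hess_holder_segment x h : sublevel f x0 x -> norm2 h <= rd ->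
  forall t, 0 <= t <= 1 ->
    spectral_norm (hess f (x + t *: h) - hess f x) <= Hf * norm2 h `^ nu.
Proof.
move=> Lx hrd t /andP[t0 t1].
have th : norm2 (t *: h) <= norm2 h.
  by rewrite norm2Z ger0_norm // ler_piMl ?norm2_ge0.
have rd0 : 0 <= rd by apply: le_trans hrd; apply: norm2_ge0.
have addK : x + t *: h - x = t *: h by rewrite addrAC subrr add0r.
apply: le_trans (hess_holder _ _ _ _) _.
- by exists x => //; rewrite subrr norm2_0.
- by exists x => //; rewrite addK; apply: le_trans hrd.
rewrite addK; apply: ler_wpM2l => //.
by apply: ge0_ler_powR; rewrite ?nnegrE ?norm2_ge0 // ltW.
Qed.

Lemma norm2_backtrack i h : norm2 (theta ^+ i *: h) <= norm2 h.
Proof.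
have th0 : 0 <= theta ^+ i by rewrite exprn_ge0 // ltW.
rewrite norm2Z ger0_norm // ler_piMl ?norm2_ge0 // exprn_ile1 //; exact: ltW.
Qed.

Lemma estimator0_trial x h : sublevel f x0 x -> norm2 h <= rd ->
  estimator0 nu f (x + h) x <= Hf.
Proof. by move=> Lx hrd; apply: estimator0_le => //; apply: hess_holder_segment. Qed.

Lemma estimator1_trial x h : sublevel f x0 x -> norm2 h <= rd ->
  estimator1 nu f (x + h) x <= Hf.
Proof. by move=> Lx hrd; apply: estimator1_le => //; apply: hess_holder_segment. Qed.

Lemma forcing_term_bounds (g : 'cV[R]_n) :
  0 <= Num.min (1 / 2) (norm2 g `^ (nu / (1 + nu))) <= 1 / 2.
Proof.
by rewrite ge_min lexx /= le_min powR_ge0 divr_ge0.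
Qed.

Lemma damping_ge (g : 'cV[R]_n) gamma : g != 0 -> 1 <= gamma ->
  norm2 g `^ (nu / (1 + nu)) <= (gamma * norm2 g `^ nu) `^ (1 + nu)^-1.
Proof.
move=> g0 ga; rewrite powRrM; have p0 := powR_ge0 (norm2 g) nu.
have nu1 : 0 <= (1 + nu)^-1 by rewrite invr_ge0 addr_ge0 // ltW.
apply: ge0_ler_powR; rewrite ?nnegrE //.
  by rewrite mulr_ge0 // (le_trans ler01).
by rewrite ler_peMl.
Qed.

Lemma damping_gt0 (g : 'cV[R]_n) gamma : g != 0 -> 1 <= gamma ->
  0 < (gamma * norm2 g `^ nu) `^ (1 + nu)^-1.
Proof.
move=> g0 ga; apply: lt_le_trans (damping_ge _ _ g0 ga).
by rewrite powR_gt0 // norm2_gt0.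
Qed.

(** Since [eps >= norm2 g `^ (nu / (1 + nu))], the step is at most
    [11 / 10 * norm2 g `^ (1 / (1 + nu))]; whether the gradient is above or below 1
    decides which of the two lower bounds for [rd] applies. *)
Lemma SOL_trial_norm x d gamma zeta : sublevel f x0 x -> grad f x != 0 ->
  1 <= gamma -> 0 <= zeta -> zeta <= 1 / 2 ->
  capped_cg (hess f x) (grad f x) zeta
    ((gamma * norm2 (grad f x) `^ nu) `^ (1 + nu)^-1) d SOL ->
  norm2 d <= rd.
Proof.
move=> Lx g0 ga z0 z1 hd; have s0 := damping_gt0 _ _ g0 ga.
have := damping_ge _ _ g0 ga; have := capped_cg_SOL_norm _ _ _ _ s0 z0 z1 _ hd.
move=> h sge; rewrite -(ler_pM2l s0); apply: le_trans h _.
have G0 : 0 < norm2 (grad f x) by rewrite norm2_gt0.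
have GU := grad_le _ Lx.
move: (_ `^ (1 + nu)^-1) s0 sge => s s0 sge.
have e1 : nu / (1 + nu) <= 1 by rewrite ler_pdivrMr ?mul1r ?lerDr ?ler01 // addr_gt0.
have e0 : 0 <= nu / (1 + nu) by rewrite divr_ge0 ?addr_ge0 // ltW.
have rd0 : 0 <= rd by apply: le_trans rd_ge; rewrite divr_ge0.
have [G1|G1] := leP 1 (norm2 (grad f x)).
  have s1 : 1 <= s.
    by apply: le_trans sge; rewrite -[leLHS](powRr0 (norm2 (grad f x))) ler_powR.
  apply: (@le_trans _ _ rd); last by rewrite ler_peMl.
  by apply: le_trans rd_geUg; rewrite ler_pM2l // divr_gt0.
have sG : norm2 (grad f x) <= s.
  by apply: le_trans sge; rewrite ger1_powR // G0 ltW.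
by rewrite mulrC ler_pM ?norm2_ge0 // divr_ge0.
Qed.

(** The scaled direction has the absolute curvature along [d] as its length. *)
Lemma NC_trial_norm x d : sublevel f x0 x ->
  norm2 (- (sgn (dot d (grad f x)) * (`|quad (hess f x) d| / norm2 d ^+ 3)) *: d)
    <= rd.
Proof.
move=> Lx; have rd0 : 0 <= rd by apply: le_trans rd_ge; rewrite divr_ge0.
have [->|d0] := eqVneq d 0; first by rewrite scaler0 norm2_0.
have dp : 0 < norm2 d by rewrite norm2_gt0.
have sgn1 : `|sgn (dot d (grad f x))| = 1 :> R.
  by rewrite /sgn; case: ifP => _; rewrite ?normrN normr1.
rewrite norm2Z normrN !normrM sgn1 mul1r normr_id normfV.
rewrite [`|_ ^+ 3|]ger0_norm ?exprn_ge0 ?norm2_ge0 // -mulrA.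
rewrite (_ : (norm2 d ^+ 3)^-1 * norm2 d = (norm2 d ^+ 2)^-1); last first.
  by field; rewrite gt_eqF.
rewrite ler_pdivrMr ?exprn_gt0 //; apply: le_trans (norm_quad _ _) _.
apply: ler_wpM2r; first by rewrite sqr_ge0.
exact: le_trans (hess_le _ Lx) rd_geUH.
Qed.

Lemma newton_cg_step_bounds x gamma x' gamma' :
  newton_cg_step f nu eta theta x gamma x' gamma' ->
  sublevel f x0 x -> 1 <= gamma ->
  [/\ f x' <= f x, gamma <= gamma' & gamma' <= Num.max gamma Hf].
Proof.
move=> [g0 [d [t [hd ht]]]] Lx ga.
have /andP[z0 z1] := forcing_term_bounds (grad f x).
have e0 := damping_gt0 _ _ g0 ga.
case: t => [|] in hd ht *.
- have dr := SOL_trial_norm _ _ _ _ Lx g0 ga z0 z1 hd.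
  have [j [[hj _] -> ->]] := ht; split.
  + apply: (le_trans (ltW hj)); rewrite gerBl.
    by rewrite !mulr_ge0 ?exprn_ge0 ?norm2_ge0 ?powR_ge0 ?(ltW eta_gt0) ?(ltW theta_gt0).
  + by rewrite le_max lexx.
  rewrite ge_max !le_max lexx /=; apply/orP; right.
  case: j {hj ht} => [|i]; first exact: estimator1_trial.
  rewrite ge_max !estimator0_trial //.
  exact: le_trans (norm2_backtrack _ _) dr.
have [j [[hj _] -> ->]] := ht; split.
- apply: (le_trans (ltW hj)); rewrite gerBl.
  by rewrite !mulr_ge0 ?invr_ge0 ?exprn_ge0 ?norm2_ge0 ?(ltW eta_gt0) ?(ltW theta_gt0).
- by rewrite le_max lexx.
rewrite ge_max !le_max lexx /=; apply/orP; right.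
case: j {hj ht} => [//|i]; apply: estimator0_trial => //.
exact: le_trans (norm2_backtrack _ _) (NC_trial_norm _ _ Lx).
Qed.

(** The upper bound for [gamma] depends on the data only, so that the neighbourhood of
    attraction can be fixed before the run. *)
Lemma generated_bounds gamma0 (x : nat -> 'cV[R]_n) (gamma : nat -> R) k :
  1 <= gamma0 -> generated f nu eta theta x0 gamma0 x gamma k ->
  [/\ sublevel f x0 (x k), 1 <= gamma k & gamma k <= Num.max gamma0 Hf].
Proof.
move=> ga0 [ex eg]; elim: k => [|k IH] steps.
  by rewrite ex eg; split => //; [exact: lexx|rewrite le_max lexx].
have [|Lx ga1 gaU] := IH; first by move=> i ik; apply/steps/ltnW.
have [fx g1 g2] := newton_cg_step_bounds _ _ _ _ (steps k (ltnSn k)) Lx ga1.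
split; [exact: le_trans Lx|exact: le_trans g1|].
by apply: le_trans g2 _; rewrite ge_max gaU le_max lexx orbT.
Qed.

End GlobalBounds.

(** * One step near a nondegenerate minimizer *)

Section LocalConvergence.
Context {R : realType} {n : nat}.
Variables (f : 'cV[R]_n -> R) (nu eta theta Hf mu rho Gam : R) (xs : 'cV[R]_n).
Hypotheses (f_C2 : twice_continuously_differentiable f)
  (nu_gt0 : 0 < nu) (Hf_ge0 : 0 <= Hf) (mu_gt0 : 0 < mu)
  (eta_lt1 : eta < 1)
  (grad_xs : grad f xs = 0)
  (hess_xs : loewner_ge (hess f xs) mu%:M)
  (rho_ge0 : 0 <= rho) (rho_le1 : rho <= 1) (Hf_rho : Hf * rho `^ nu <= mu / 4)
  (hess_holder : forall x y, norm2 (x - xs) <= rho -> norm2 (y - xs) <= rho ->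
     spectral_norm (hess f y - hess f x) <= Hf * norm2 (y - x) `^ nu).
Implicit Types x y z d v : 'cV[R]_n.

(* bound for the Hessian on the ball of radius [rho] *)
Let M := spectral_norm (hess f xs) + mu / 4.

Lemma segment_in_ball x y t : norm2 (x - xs) <= rho -> norm2 (y - xs) <= rho ->
  0 <= t <= 1 -> norm2 (x + t *: (y - x) - xs) <= rho.
Proof.
move=> xr yr /andP[t0 t1].
rewrite (_ : _ - xs = (1 - t) *: (x - xs) + t *: (y - xs)); last first.
  rewrite !scalerBr !scalerBl !scale1r; apply/matrixP => i j; rewrite !mxE; ring.
apply: le_trans (norm2D _ _) _; rewrite !norm2Z !ger0_norm ?subr_ge0 //.
rewrite [leRHS](_ : rho = (1 - t) * rho + t * rho); last by ring.
by rewrite lerD // ler_wpM2l // subr_ge0.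
Qed.

Lemma hess_near_minimizer z : norm2 (z - xs) <= rho ->
  spectral_norm (hess f z - hess f xs) <= mu / 4.
Proof.
move=> zr; have xr : norm2 (xs - xs) <= rho by rewrite subrr norm2_0.
apply: le_trans (hess_holder _ _ xr zr) _; apply: le_trans Hf_rho.
apply: ler_wpM2l => //; apply: ge0_ler_powR; rewrite ?nnegrE ?norm2_ge0 //.
exact: ltW.
Qed.

Lemma quad_hess_near z v : norm2 (z - xs) <= rho ->
  `|quad (hess f z) v - quad (hess f xs) v| <= mu / 4 * norm2 v ^+ 2.
Proof.
move=> zr; rewrite -quadB; apply: le_trans (norm_quad _ _) _.
by apply: ler_wpM2r (hess_near_minimizer _ zr); rewrite sqr_ge0.
Qed.

Lemma quad_hess_ge z v : norm2 (z - xs) <= rho ->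
  3 / 4 * mu * norm2 v ^+ 2 <= quad (hess f z) v.
Proof.
move=> /(quad_hess_near _ v); rewrite ler_norml => /andP[h _].
have := hess_xs v; rewrite quadB quad_scalar.
by move: h; generalize (quad (hess f z) v) (quad (hess f xs) v) => a b; lra.
Qed.

Lemma norm2_hess_ge z v : norm2 (z - xs) <= rho ->
  3 / 4 * mu * norm2 v <= norm2 (hess f z *m v).
Proof.
move=> zr; have [->|v0] := eqVneq v 0; first by rewrite norm2_0 mulr0 norm2_ge0.
rewrite -(ler_pM2r (x := norm2 v)) ?norm2_gt0 // -(mulrA _ (norm2 v)) -expr2.
apply: le_trans (quad_hess_ge _ v zr) _; rewrite quadE mulrC.
exact: dot_le.
Qed.

Lemma norm2_hess_le z v : norm2 (z - xs) <= rho ->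
  norm2 (hess f z *m v) <= M * norm2 v.
Proof.
move=> zr; rewrite -(subrK (hess f xs) (hess f z)) mulmxDl addrC.
apply: le_trans (norm2D _ _) _; rewrite /M mulrDl; apply: lerD.
  exact: norm2_mulmx.
apply: le_trans (norm2_mulmx _ _) _.
by apply: ler_wpM2r (hess_near_minimizer _ zr); rewrite norm2_ge0.
Qed.

(** The mean value theorem is used for the component along the gradient itself. *)
Lemma norm2_grad_le x : norm2 (x - xs) <= rho ->
  norm2 (grad f x) <= M * norm2 (x - xs).
Proof.
move=> xr; have [->|g0] := eqVneq (grad f x) 0.
  rewrite norm2_0 mulr_ge0 ?norm2_ge0 // addr_ge0 ?spectral_norm_ge0 //.
  by rewrite divr_ge0 // ltW.
have [t tI] := mean_value_grad _ xs (x - xs) (grad f x) f_C2.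
rewrite addrCA subrr addr0 grad_xs subr0 -sqr_norm2 => e.
rewrite -(ler_pM2l (x := norm2 (grad f x))) ?norm2_gt0 // -expr2 e.
apply: le_trans (dot_le _ _) _; apply: ler_wpM2l (norm2_ge0 _) _ _ _.
apply: norm2_hess_le; apply: segment_in_ball => //.
by rewrite subrr norm2_0.
Qed.

(** Newton's remainder: this is the first order residual at [x], evaluated at [xs]. *)
Lemma residual1_minimizer x : norm2 (x - xs) <= rho ->
  norm2 (hess f x *m (x - xs) - grad f x) <= Hf * norm2 (x - xs) `^ (1 + nu).
Proof.
move=> xr; have sr : norm2 (xs - xs) <= rho by rewrite subrr norm2_0.
rewrite powRD; last by rewrite gt_eqF ?addr_gt0.
rewrite powRr1 ?norm2_ge0 // (mulrC (norm2 _)) mulrA (norm2BC x).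
rewrite (_ : _ - grad f x
    = grad f (x + (xs - x)) - grad f x - hess f x *m (x + (xs - x) - x)).
  apply: residual1_le => // t tI.
  have tr := segment_in_ball _ _ _ xr sr tI.
  apply: le_trans (hess_holder _ _ xr tr) _; apply: ler_wpM2l => //.
  have /andP[t0 t1] := tI.
  rewrite addrAC subrr add0r norm2Z ger0_norm //.
  apply: ge0_ler_powR; rewrite ?nnegrE ?mulr_ge0 ?norm2_ge0 //; first exact: ltW.
  by rewrite ler_piMl ?norm2_ge0.
rewrite (addrCA x) subrr addr0 grad_xs sub0r -(opprB x) mulmxN opprK.
by rewrite addrC.
Qed.

Section SolStep.
Variables (x d : 'cV[R]_n) (zeta eps : R).
Hypotheses (x_near : norm2 (x - xs) <= rho) (eps_gt0 : 0 < eps)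
  (zeta_ge0 : 0 <= zeta) (zeta_le : zeta <= 1 / 2) (g_neq0 : grad f x != 0)
  (d_SOL : capped_cg (hess f x) (grad f x) zeta eps d SOL).

Lemma SOL_step_norm : norm2 d <= 2 / mu * norm2 (grad f x).
Proof.
have := capped_cg_SOL_quad _ _ _ _ eps_gt0 zeta_ge0 zeta_le _ d_SOL.
have := quad_hess_ge _ d x_near.
rewrite (quadE (cg_Hbar _ _)) mulmxDl mul_scalar_mx dotDr dotZr -quadE -sqr_norm2.
have [->|d0] := eqVneq d 0.
  by rewrite norm2_0 mulr_ge0 ?norm2_ge0 // divr_ge0 // ltW.
have dp : 0 < norm2 d by rewrite norm2_gt0.
have edd : 0 <= eps * norm2 d ^+ 2 by rewrite mulr_ge0 ?sqr_ge0 // ltW.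
have G0 := norm2_ge0 (grad f x).
rewrite -(mulrA (3 / 4)) -(mulrA 2) -(mulrA (11 / 10)) => h1 h2.
rewrite mulrAC ler_pdivlMr // -(ler_pM2r dp) -(mulrA 2).
rewrite (_ : norm2 d * mu * norm2 d = mu * norm2 d ^+ 2); last by ring.
have := mulr_ge0 G0 (ltW dp); move: h1 h2 edd.
move: (norm2 _ * _) (mu * _) (eps * _) (quad _ _) => a b c e; lra.
Qed.

(** The inexact Newton equation, in which the damping acts as a perturbation of the
    same order as the residual. *)
Lemma SOL_step_newton : exists2 r : 'cV[R]_n, norm2 r <= eps * norm2 d / 4 &
  hess f x *m d = r - grad f x - (2 * eps) *: d.
Proof.
have [_ _ h] := capped_cg_SOL _ _ _ _ eps_gt0 zeta_ge0 zeta_le _ d_SOL.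
exists (cg_Hbar (hess f x) eps *m d + grad f x).
  apply: le_trans h _.
  have : 0 <= eps * norm2 d by rewrite mulr_ge0 ?norm2_ge0 // ltW.
  rewrite -(mulrA zeta); move: (eps * _) => e e0.
  have := ler_wpM2r e0 zeta_le; lra.
by rewrite addrK mulmxDl mul_scalar_mx addrK.
Qed.

(** A zero step would have a zero residual, that is, a zero gradient. *)
Lemma SOL_step_neq0 : d != 0.
Proof.
apply: contraNneq (g_neq0) => d0; have [r] := SOL_step_newton.
rewrite d0 mulmx0 norm2_0 mulr0 mul0r scaler0 subr0 => r0 /esym/eqP.
rewrite subr_eq0 => /eqP <-.
by rewrite -norm2_eq0 eq_le r0 norm2_ge0.
Qed.

(** The curvature [mu] absorbs the variation of the Hessian along the step, so that
    the damping term alone gives the required decrease. *)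
Lemma SOL_unit_step_accepted : norm2 (x + d - xs) <= rho ->
  f (x + d) < f x - eta * eps * norm2 d ^+ 2.
Proof.
have [r r_le hess_d] := SOL_step_newton.
move=> xdr; have dp : 0 < norm2 d by rewrite norm2_gt0 SOL_step_neq0.
have gd : dot (grad f x) d
    <= eps * norm2 d ^+ 2 / 4 - quad (hess f x) d - 2 * (eps * norm2 d ^+ 2).
  rewrite (quadE (hess f x)) hess_d !dotBr dotZr -sqr_norm2 (dotC d (grad f x)).
  have : dot d r <= eps * norm2 d ^+ 2 / 4.
    apply: le_trans (dot_le _ _) _.
    apply: le_trans (ler_wpM2l (norm2_ge0 _) r_le) _.
    by rewrite expr2 !mulrA (mulrC (norm2 d)).
  rewrite -(mulrA 2).
  generalize (dot d r) (dot d (grad f x)) => a b; lra.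
have [t tI ->] := taylor2_line _ x d f_C2.
have zr : norm2 (x + t *: d - xs) <= rho.
  have := segment_in_ball _ _ _ x_near xdr tI.
  by rewrite (_ : x + d - x = d) // addrAC subrr add0r.
have := quad_hess_near _ d zr; rewrite ler_norml => /andP[_ hz].
have := quad_hess_near _ d x_near; rewrite ler_norml => /andP[hx _].
have hq := quad_hess_ge _ d x_near.
have ed : 0 < eps * norm2 d ^+ 2 by rewrite mulr_gt0 // exprn_gt0.
have ee : eta * (eps * norm2 d ^+ 2) < eps * norm2 d ^+ 2 by rewrite gtr_pMl.
have md : 0 < mu * norm2 d ^+ 2 by rewrite mulr_gt0 // exprn_gt0.
rewrite -(mulrA eta).
move: hz hx hq gd ee ed md.
generalize (norm2 d ^+ 2) (f x) (dot (grad f x) d) (quad (hess f (x + t *: d)) d).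
generalize (quad (hess f x) d) (quad (hess f xs) d) => a b s c e g; lra.
Qed.

(** With [A = hess f x], the new error [e] satisfies [A e = (A (x - xs) - grad f x) +
    r - 2 eps d]: Newton's remainder plus the effect of damping. *)
Lemma SOL_unit_step_error :
  norm2 (x + d - xs) <=
    2 / mu * (Hf * norm2 (x - xs) `^ (1 + nu) + 3 * eps * norm2 d).
Proof.
have [r r_le hess_d] := SOL_step_newton.
have h := norm2_hess_ge _ (x + d - xs) x_near.
have e : hess f x *m (x + d - xs)
    = (hess f x *m (x - xs) - grad f x) + (r - (2 * eps) *: d).
  by rewrite addrAC mulmxDr hess_d -!addrA (addrCA r).
have : norm2 (hess f x *m (x + d - xs))
    <= Hf * norm2 (x - xs) `^ (1 + nu) + 3 * eps * norm2 d.
  rewrite e; apply: le_trans (norm2D _ _) _.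
  apply: lerD; first exact: residual1_minimizer.
  apply: le_trans (norm2B _ _) _; rewrite norm2Z ger0_norm; last first.
    by rewrite mulr_ge0 // ltW.
  have := r_le; have : 0 <= eps * norm2 d by rewrite mulr_ge0 ?norm2_ge0 // ltW.
  generalize (norm2 r) (norm2 d) => a b; lra.
move=> /(le_trans h) {}h; rewrite mulrAC ler_pdivlMr //.
have : 0 <= mu * norm2 (x + d - xs) by rewrite mulr_ge0 ?norm2_ge0 // ltW.
move: h; generalize (norm2 (x + d - xs)).
generalize (Hf * norm2 (x - xs) `^ (1 + nu) + 3 * eps * norm2 d) => a b; lra.
Qed.

End SolStep.

(** The factor [(Gam * M `^ nu) `^ (1 + nu)^-1] bounds [eps] and [2 / mu * M] bounds
    [norm2 d], relative to the powers of the error. *)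
Definition contraction_const : R :=
  2 / mu * (Hf + 3 * ((Gam * M `^ nu) `^ (1 + nu)^-1) * (2 / mu * M)).

Lemma damping_le (g : 'cV[R]_n) (gamma c e : R) :
  0 <= gamma -> gamma <= Gam -> 0 <= c -> 0 <= e -> norm2 g <= c * e ->
  (gamma * norm2 g `^ nu) `^ (1 + nu)^-1
    <= (Gam * c `^ nu) `^ (1 + nu)^-1 * e `^ (nu / (1 + nu)).
Proof.
move=> ga0 gaG c0 e0 gce; have G0 := le_trans ga0 gaG.
have nu0 := ltW nu_gt0.
have nu1 : 0 <= (1 + nu)^-1 by rewrite invr_ge0 addr_ge0.
rewrite powRrM -powRM ?mulr_ge0 ?powR_ge0 //.
apply: ge0_ler_powR; rewrite ?nnegrE ?mulr_ge0 ?powR_ge0 //.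
rewrite -mulrA -powRM //; apply: ler_pM; rewrite ?powR_ge0 //.
by apply: ge0_ler_powR; rewrite ?nnegrE ?norm2_ge0 ?mulr_ge0.
Qed.

(** The condition on [x] keeps [x + d] in the ball of radius [rho], the step being
    at most [2 / mu * M] times the error. *)
Lemma newton_cg_local_step x gamma x' gamma' :
  (1 + 2 / mu * M) * norm2 (x - xs) <= rho -> 1 <= gamma -> gamma <= Gam ->
  newton_cg_step f nu eta theta x gamma x' gamma' ->
  norm2 (x' - xs)
    <= contraction_const * norm2 (x - xs) `^ ((1 + 2 * nu) / (1 + nu)).
Proof.
move=> xr1 ga1 gaG [g0 [d [t [hd ht]]]].
have M0 : 0 <= M by rewrite addr_ge0 ?spectral_norm_ge0 // divr_ge0 // ltW.
have mu2 : 0 <= 2 / mu by rewrite divr_ge0 // ltW.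
have e0 := norm2_ge0 (x - xs).
have xr : norm2 (x - xs) <= rho.
  apply: le_trans xr1; rewrite ler_peMl // lerDl mulr_ge0 //.
have /andP[z0 z1] := forcing_term_bounds nu (grad f x).
have s0 := damping_gt0 nu nu_gt0 _ _ g0 ga1.
have sle := damping_le _ _ _ _ (le_trans ler01 ga1) gaG M0 e0 (norm2_grad_le _ xr).
case: t => [|] in hd ht *; last first.
  (* the direction of small curvature contradicts the lower bound for the Hessian *)
  have [v] := capped_cg_NC_negcurv _ _ _ _ _ hd.
  rewrite /cg_negcurv quadE mulmxDl mul_scalar_mx dotDr dotZr -quadE -sqr_norm2.
  have := quad_hess_ge _ v xr.
  have : 0 <= mu * norm2 v ^+ 2 by rewrite mulr_ge0 ?sqr_ge0 // ltW.
  have : 0 <= _ `^ (1 + nu)^-1 * norm2 v ^+ 2 := mulr_ge0 (ltW s0) (sqr_ge0 _).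
  rewrite -(mulrA 2) -(mulrA (3 / 4)).
  move: (_ * norm2 v ^+ 2) (quad _ _) (mu * _) => a b c; lra.
have [j [[_ jmin] -> _]] := ht.
move: (_ `^ (1 + nu)^-1) s0 sle hd ht jmin => eps eps0 epsle hd _ jmin.
have dle := SOL_step_norm _ _ _ _ xr eps0 z0 z1 hd.
have {}dle : norm2 d <= 2 / mu * M * norm2 (x - xs).
  by apply: le_trans dle _; rewrite -(mulrA _ M) ler_wpM2l // norm2_grad_le.
have xdr : norm2 (x + d - xs) <= rho.
  apply: le_trans xr1; rewrite addrAC; apply: le_trans (norm2D _ _) _.
  by rewrite mulrDl mul1r lerD2l.
have j0 : j = 0%N.
  case: j jmin => // j /(_ 0%N isT); case.
  rewrite expr0 scale1r mulr1.
  exact: SOL_unit_step_accepted xr eps0 z0 z1 g0 hd xdr.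
rewrite j0 expr0 scale1r.
apply: le_trans (SOL_unit_step_error _ _ _ _ xr eps0 z0 z1 hd) _.
rewrite /contraction_const -[leRHS]mulrA; apply: ler_wpM2l => //.
have nu0 := ltW nu_gt0.
have pE : (1 + 2 * nu) / (1 + nu) = 1 + nu / (1 + nu) by field; rewrite gt_eqF ?addr_gt0.
rewrite pE [leRHS]mulrDl; apply: lerD.
  apply: ler_wpM2l => //.
  have [->|xx] := eqVneq (norm2 (x - xs)) 0.
    by rewrite !powR0 ?gt_eqF ?addr_gt0 ?divr_gt0 ?addr_gt0.
  apply: ger_powR; first by rewrite lt_neqAle eq_sym xx e0 (le_trans xr).
  by rewrite lerD2l ler_pdivrMr ?addr_gt0 // ler_peMr // lerDl.
rewrite powRD; last by rewrite gt_eqF ?addr_gt0 ?divr_gt0 ?addr_gt0.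
rewrite powRr1 // -!mulrA ler_pM2l //.
have sd := ler_pM (ltW eps0) (norm2_ge0 d) epsle dle.
by apply: le_trans sd _; rewrite !mulrA le_eqVlt; apply/orP; left; apply/eqP; ring.
Qed.

End LocalConvergence.

(** * Superlinear convergence *)

Section Rates.
Context {R : realType}.

Lemma exists_powR_le (c b s : R) : 0 < c -> 0 < b -> 0 < s ->
  exists2 r : R, 0 < r & c * r `^ s <= b.
Proof.
move=> c0 b0 s0; exists ((b / c) `^ s^-1); first by apply/powR_gt0/divr_gt0.
rewrite -powRrM mulVf ?gt_eqF // powRr1; last exact/ltW/divr_gt0.
by rewrite mulrC divfK ?gt_eqF.
Qed.

Lemma cvg_of_geometric_bound {n : nat} (x : nat -> 'cV[R]_n) (xs : 'cV[R]_n)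
    (delta : R) (k0 : nat) :
  (forall k, (k0 <= k)%N -> norm2 (x k - xs) <= delta * 2^-1 ^+ (k - k0)) ->
  x k @[k --> \oo] --> xs.
Proof.
move=> hx; rewrite -(cvg_shiftn k0); apply/cvgrPdist_lt => e e0.
have half : `|2^-1 : R| < 1 by rewrite ger0_norm ?invr_ge0 // invf_lt1 // ltr1n.
have /cvgrPdist_lt/(_ e e0) := cvg_geometric delta half.
apply: filterS => k; rewrite sub0r normrN; apply: le_lt_trans.
apply: le_trans (norm_le_norm2 _) _; rewrite norm2BC.
apply: le_trans (hx _ (leq_addl _ _)) _; rewrite addnK.
exact: ler_norm.
Qed.

End Rates.

Lemma generatedW (R : realType) (n : nat) (f : 'cV[R]_n -> R) (nu eta theta : R)
    (x0 : 'cV[R]_n) (gamma0 : R) x gamma (i k : nat) : (i <= k)%N ->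
  generated f nu eta theta x0 gamma0 x gamma k ->
  generated f nu eta theta x0 gamma0 x gamma i.
Proof.
by move=> ik [e1 e2 h]; split => // j ji; apply: h; apply: leq_trans ik.
Qed.

Theorem theorem2 (R : realType) (n : nat) (f : 'cV[R]_n -> R)
    (x0 : 'cV[R]_n) (Ug UH nu Hf gamma0 eta theta mu : R) (xs : 'cV[R]_n)
    (f_C2 : twice_continuously_differentiable f)
    (x0_compact : compact (sublevel f x0))
    (Ug_gt0 : 0 < Ug) (UH_gt0 : 0 < UH)
    (grad_le : forall x, sublevel f x0 x -> norm2 (grad f x) <= Ug)
    (hess_le : forall x, sublevel f x0 x -> spectral_norm (hess f x) <= UH)
    (nu_gt0 : 0 < nu) (nu_le1 : nu <= 1) (Hf_ge1 : 1 <= Hf)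
    (hess_holder :
      let r_d := Num.max (11 / 10) (Num.max (11 / 10 * Ug) UH) in
      forall x y, sublevel_nbhd f x0 r_d x -> sublevel_nbhd f x0 r_d y ->
        spectral_norm (hess f y - hess f x) <= Hf * norm2 (y - x) `^ nu)
    (gamma0_ge1 : 1 <= gamma0)
    (eta_gt0 : 0 < eta) (eta_lt1 : eta < 1)
    (theta_gt0 : 0 < theta) (theta_lt1 : theta < 1)
    (xs_min : local_minimizer f xs)
    (mu_gt0 : 0 < mu) (xs_nondegenerate : loewner_ge (hess f xs) mu%:M) :
  exists delta : R, 0 < delta /\
    forall (x : nat -> 'cV[R]_n) (gamma : nat -> R) (k0 : nat),
      let gen := generated f nu eta theta x0 gamma0 x gamma in
      gen k0 -> eball xs delta (x k0) ->
      [/\ forall k, (k0 <= k)%N -> gen k -> eball xs delta (x k),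
          (forall k, gen k) -> x k @[k --> \oo] --> xs
        & exists C : R, forall k, (k0 <= k)%N -> gen k.+1 ->
            norm2 (x k.+1 - xs)
              <= C * norm2 (x k - xs) `^ ((1 + 2 * nu) / (1 + nu))].
Proof.
have Hf0 : 0 <= Hf by exact: le_trans Hf_ge1.
pose rd := Num.max (11 / 10) (Num.max (11 / 10 * Ug) UH).
have rd1 : 11 / 10 <= rd by rewrite le_max lexx.
have rdg : 11 / 10 * Ug <= rd by rewrite !le_max lexx orbT.
have rdH : UH <= rd by rewrite !le_max lexx !orbT.
have bounds := generated_bounds f x0 nu eta theta Ug UH Hf rd f_C2 grad_le hess_le
  nu_gt0 Hf0 rd1 rdg rdH hess_holder eta_gt0 theta_gt0 theta_lt1 gamma0.
have [xsL|xsL] := leP (f xs) (f x0); last first.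
  (* the minimizer is outside the sublevel set *)
  have [e e0 he] : exists2 e : R, 0 < e & forall z, `|xs - z| < e -> f x0 < f z.
    have [df _ _] := f_C2; have cf := differentiable_continuous (df xs).
    have /nbhs_ballP[e /= e0 he] : \forall z \near xs, f x0 < f z.
      exact: cvgr_gt cf _ xsL.
    by exists e => // z xz; apply: he; rewrite -ball_normE.
  exists (e / 2); split; first by rewrite divr_gt0.
  move=> x gamma k0 gen gk xk; exfalso.
  have [Lx _ _] := bounds _ _ _ gamma0_ge1 gk.
  have : f x0 < f (x k0).
    apply: he; rewrite distrC; apply: le_lt_trans (norm_le_norm2 _) _.
    by apply: le_lt_trans xk _; rewrite ltr_pdivrMr // ltr_pMr // ltr1n.
  by rewrite ltNge; move: Lx; rewrite /sublevel /= => ->.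
have gxs := grad_local_minimizer _ _ f_C2 xs_min.
have [r r0 hr] : exists2 r : R, 0 < r & Hf * r `^ nu <= mu / 4.
  by apply: exists_powR_le; rewrite ?divr_gt0 // (lt_le_trans ltr01).
pose rho := Num.min 1 r.
have rho1 : rho <= 1 by rewrite ge_min lexx.
have rho0 : 0 < rho by rewrite lt_min ltr01 r0.
have Hrho : Hf * rho `^ nu <= mu / 4.
  apply: le_trans hr; rewrite ler_wpM2l //.
  by apply: ge0_ler_powR; rewrite ?nnegrE ?ge_min ?lexx ?orbT //; exact: ltW.
have near_holder y z : norm2 (y - xs) <= rho -> norm2 (z - xs) <= rho ->
    spectral_norm (hess f z - hess f y) <= Hf * norm2 (z - y) `^ nu.
  have rhord : rho <= rd by apply: le_trans rd1; apply: (le_trans rho1); lra.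
  by move=> yr zr; apply: hess_holder; exists xs => //; apply: le_trans rhord.
pose Gam := Num.max gamma0 Hf.
have step := newton_cg_local_step f nu eta theta Hf mu rho Gam xs f_C2 nu_gt0 Hf0
  mu_gt0 eta_lt1 gxs xs_nondegenerate (ltW rho0) rho1 Hrho near_holder.
set C := contraction_const _ _ _ _ _ _ in step.
pose s := nu / (1 + nu); have s0 : 0 < s by rewrite divr_gt0 // addr_gt0.
have pE : (1 + 2 * nu) / (1 + nu) = s + 1.
  by rewrite /s; field; rewrite gt_eqF ?addr_gt0.
rewrite pE in step *.
have C1 : 0 < Num.max 1 C by rewrite lt_max ltr01.
have [b b0 hb] : exists2 b : R, 0 < b & Num.max 1 C * b `^ s <= 2^-1.
  by apply: exists_powR_le; rewrite // invr_gt0.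
set L := 1 + _ in step.
have L0 : 0 < L.
  rewrite ltr_pwDl // mulr_ge0 ?addr_ge0 ?spectral_norm_ge0 ?divr_ge0 //; exact: ltW.
(* rho / L keeps the step in the ball of radius rho, b makes it halve the error *)
pose delta := Num.min (rho / L) b.
have delta0 : 0 < delta by rewrite lt_min b0 divr_gt0.
exists delta; split => // x gamma k0 gen gk0 xk0.
have step_k k : gen k.+1 -> norm2 (x k - xs) <= delta ->
    norm2 (x k.+1 - xs) <= C * norm2 (x k - xs) `^ (s + 1).
  move=> gk1 xk; have gk : gen k by exact: generatedW (leqnSn k) gk1.
  have [_ ga1 gaG] := bounds _ _ _ gamma0_ge1 gk.
  have [_ _ steps] := gk1; apply: step ga1 gaG (steps k (ltnSn k)).
  by rewrite mulrC -ler_pdivlMr // (le_trans xk) // ge_min lexx.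
have half k : gen k.+1 -> norm2 (x k - xs) <= delta ->
    norm2 (x k.+1 - xs) <= norm2 (x k - xs) / 2.
  move=> gk1 xk; apply: le_trans (step_k k gk1 xk) _.
  have e0 := norm2_ge0 (x k - xs); move: (norm2 (x k - xs)) xk e0 => e ed e0.
  rewrite powRD; last by rewrite gt_eqF // addr_gt0.
  rewrite powRr1 // mulrA (mulrC e); apply: ler_wpM2r => //.
  have Cmax : C <= Num.max 1 C by rewrite le_max lexx orbT.
  apply: le_trans hb; apply: le_trans (ler_wpM2r (powR_ge0 _ _) Cmax) _.
  apply: ler_wpM2l; first exact: ltW.
  apply: ge0_ler_powR; rewrite ?nnegrE //; try exact: ltW.
  by apply: le_trans ed _; rewrite ge_min lexx orbT.
have geo m : gen (k0 + m)%N -> norm2 (x (k0 + m)%N - xs) <= delta * 2^-1 ^+ m.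
  elim: m => [|m IH]; first by rewrite addn0 expr0 mulr1.
  rewrite addnS => gm1.
  have gm : gen (k0 + m)%N by exact: generatedW (leqnSn _) gm1.
  have hm : 2^-1 ^+ m <= 1 :> R by rewrite exprn_ile1 // invf_le1 // ler1n.
  have md : norm2 (x (k0 + m)%N - xs) <= delta.
    by apply: le_trans (IH gm) _; rewrite ler_piMr // ltW.
  apply: le_trans (half _ gm1 md) _.
  by rewrite exprSr mulrA ler_wpM2r // IH.
have stay k : (k0 <= k)%N -> gen k -> norm2 (x k - xs) <= delta * 2^-1 ^+ (k - k0).
  by move=> /subnKC {1 2}<-; exact: geo.
have ball_k k : (k0 <= k)%N -> gen k -> eball xs delta (x k).
  move=> k0k gk; apply: le_trans (stay k k0k gk) _.
  by rewrite ler_piMr ?(ltW delta0) // exprn_ile1 // invf_le1 // ler1n.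
split=> // [gall|].
  by apply: (cvg_of_geometric_bound _ _ delta k0) => k k0k; apply: stay.
exists C => k k0k gk1; apply: step_k => //; apply: ball_k => //.
exact: generatedW (leqnSn k) gk1.
Qed.
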